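(* Let $A_1,\dots,A_m\in\mathbb{R}_+^{3\times 3}$ ($m\ge1$) be SR-matrices (symmetrically reciprocal matrices). Write $\hat A_i=A_i/\mu(A_i)$ and $\hat S=\hat A_1\oplus\cdots\oplus\hat A_m$. The following are equivalent: (i) $\mu(\hat S)=1$; (ii) $A_i\otimes A_j=A_j\otimes A_i$ for all $i,j\in\{1,\dots,m\}$; (iii) there exists a vector $x\in\operatorname{int}(\mathbb{R}^3_+)$ with $A_i\otimes x\le\mu(A_i)x$ for all $i\in\{1,\dots,m\}$.
   Context: $\mathbb{R}_+$ is the set of nonnegative reals and $\operatorname{int}(\mathbb{R}^n_+)$ is the set of $n$-tuples of positive reals. An SR-matrix (symmetrically reciprocal matrix) is a matrix $A$ with all entries positive, $a_{ii}=1$ for all $i$ and $a_{ij}a_{ji}=1$ for all $i\neq j$. Max algebra: $a\oplus b=\max(a,b)$, $a\otimes b=ab$ on $\mathbb{R}_+$, extended to matrices and vectors: $(A\oplus B)_{ij}=\max(a_{ij},b_{ij})$, $(A\otimes B)_{ij}=\max_k a_{ik}b_{kj}$, $(A\otimes x)_i=\max_j a_{ij}x_j$. Vector inequalities are entrywise. For $A\in\mathbb{R}_+^{n\times n}$, $\mu(A)$ is the maximal cycle geometric mean: the maximum of $(a_{i_1i_2}a_{i_2i_3}\cdots a_{i_ki_1})^{1/k}$ over all $k\ge 1$ and all sequences of distinct indices $i_1,\dots,i_k$. For an SR-matrix, $\mu(A)\ge 1$. *)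

(* Defs.v *)
From HB Require Import structures.
From mathcomp Require Import all_boot all_order all_algebra.
From mathcomp Require Import reals exp.
Set Implicit Arguments.
Unset Strict Implicit.
Unset Printing Implicit Defensive.
Import Order.TTheory GRing.Theory Num.Theory.
Local Open Scope ring_scope.

Section MaxAlgebra.
Context {R : realType}.

Definition sr_matrix n (A : 'M[R]_n) : Prop :=
  [/\ forall i j, 0 < A i j,
      forall i, A i i = 1
    & forall i j, i != j -> A i j * A j i = 1].

Definition max_addmx m n (A B : 'M[R]_(m, n)) : 'M[R]_(m, n) :=
  \matrix_(i, j) Num.max (A i j) (B i j).

(* The default value 0 is the zero of the max algebra: the result is the
   max-times product whenever all entries are nonnegative. Matrix-vector
   products are the case p = 1. *)
Definition max_mulmx m n p (A : 'M[R]_(m, n)) (B : 'M[R]_(n, p)) :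
    'M[R]_(m, p) :=
  \matrix_(i, j) \big[Num.max/0]_(k < n) (A i k * B k j).

(* ordS is the cyclic successor, so the last factor closes the cycle. *)
Definition cycle_weight n (A : 'M[R]_n) k (s : k.-tuple 'I_n) : R :=
  \prod_(l < k) A (tnth s l) (tnth s (ordS l)).

(* Distinctness of the indices forces k <= n, so the maximum over all k >= 1
   is a finite one; the default value 0 is harmless for n >= 1 and nonnegative
   entries. *)
Definition max_cycle_mean n (A : 'M[R]_n) : R :=
  \big[Num.max/0]_(1 <= k < n.+1)
    \big[Num.max/0]_(s : k.-tuple 'I_n | uniq s)
      (cycle_weight A s `^ k%:R^-1).

Definition normalized_mx n (A : 'M[R]_n) : 'M[R]_n :=
  (max_cycle_mean A)^-1 *: A.

(* For nonnegative summands, the zero matrix is neutral. *)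
Definition max_summx m n p (A : 'I_m -> 'M[R]_(n, p)) : 'M[R]_(n, p) :=
  \big[@max_addmx n p/0]_(i < m) A i.

Definition mx_le m n (A B : 'M[R]_(m, n)) : Prop :=
  forall i j, A i j <= B i j.

End MaxAlgebra.

(* Main.v *)
(** Put q = a_12 a_23 a_31. One of the two orientations of the 3-cycle of an
    SR-matrix A has weight max(q, 1/q) = mu(A)^3 >= 1, and this determines a
    positive x with A x = mu(A) x. Going around the critical cycle, any
    positive z with A z <= mu(A) z is proportional to x, and A is the
    conjugate by diag(z) of a circulant matrix. So if the A_i have a common z,
    they commute, because circulants do. Conversely, if B commutes with A then
    B x is a subeigenvector of A, hence proportional to x, and the factor is
    at most mu(B). Finally, if mu(S) = 1, the eigenvector x of A_1 satisfies
    S x <= x: the entries of S along the critical cycle of A_1 are at least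
    x_i / x_j, and cycles of S have weight at most 1, which bounds all its
    entries from above. *)

Require Import Defs.
From HB Require Import structures.
From mathcomp Require Import all_boot all_order all_algebra.
From mathcomp Require Import reals exp.
From mathcomp Require Import ring.
Set Implicit Arguments.
Unset Strict Implicit.
Unset Printing Implicit Defensive.
Import Order.TTheory GRing.Theory Num.Theory.
Local Open Scope ring_scope.

(** * Bounds on the maximal cycle geometric mean *)

Lemma max_cycle_mean_ge0 (R : realType) n (A : 'M[R]_n) :
  0 <= max_cycle_mean A.
Proof. exact: bigmax_ge_id. Qed.

Lemma cycle_weight_ge0 (R : realType) n (A : 'M[R]_n) k (s : k.-tuple 'I_n) :
  (forall i j, 0 <= A i j) -> 0 <= cycle_weight A s.
Proof. by move=> A_ge0; apply: prodr_ge0. Qed.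

Lemma cycle_weight_le_mean (R : realType) n (A : 'M[R]_n) k
    (s : k.-tuple 'I_n) :
    (forall i j, 0 <= A i j) -> (0 < k)%N -> uniq s ->
  cycle_weight A s <= max_cycle_mean A ^+ k.
Proof.
move=> A_ge0 k_gt0 s_uniq.
have w_ge0 := cycle_weight_ge0 s A_ge0.
have k_neq0 : k%:R != 0 :> R by rewrite pnatr_eq0 -lt0n.
have -> : cycle_weight A s = (cycle_weight A s `^ k%:R^-1) ^+ k.
  by rewrite -powR_mulrn ?powR_ge0// -powRrM mulVf// powRr1.
rewrite lerXn2r ?nnegrE ?powR_ge0 ?max_cycle_mean_ge0//.
(* Distinct indices number at most [n], so [k] lies in the range of the outer maximum. *)
have k_le : (k <= n)%N.
  by move: s_uniq => /card_uniqP; rewrite size_tuple => <-;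
     rewrite -[n in (_ <= n)%N]card_ord max_card.
apply: (@bigmax_sup_seq _ _ _ _ _ k) => //.
  by rewrite mem_index_iota k_gt0 ltnS.
exact: (le_bigmax_cond _ (fun s : k.-tuple 'I_n => cycle_weight A s `^ k%:R^-1)).
Qed.

(** Multiplying the inequalities along a cycle of length [k] cancels the entries of [x] and leaves
    weight at most [t ^+ k]. *)
Lemma max_cycle_mean_le (R : realType) n (A : 'M[R]_n) (x : 'cV[R]_n) (t : R) :
    (forall i j, 0 <= A i j) -> (forall i, 0 < x i 0) -> 0 <= t ->
    (forall i j, A i j * x j 0 <= t * x i 0) ->
  max_cycle_mean A <= t.
Proof.
move=> A_ge0 x_gt0 t_ge0 Ax_le.
rewrite /max_cycle_mean big_seq_cond; apply: bigmax_le => // k.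
rewrite mem_index_iota andbT => /andP[k_gt0 _]; apply: bigmax_le => // s _.
have k_neq0 : k%:R != 0 :> R by rewrite pnatr_eq0 -lt0n.
have -> : t = (t ^+ k) `^ k%:R^-1.
  by rewrite -powR_mulrn// -powRrM mulfV// powRr1.
rewrite ge0_ler_powR ?nnegrE ?invr_ge0 ?ler0n ?exprn_ge0 ?cycle_weight_ge0//.
have prod_gt0 : 0 < \prod_(l < k) x (tnth s l) 0 by apply: prodr_gt0 => *.
(* ordS permutes the positions, so the factors of x telescope around s. *)
rewrite -(ler_pM2r prod_gt0) [X in _ * X <= _](reindex_inj (@ordS_inj k)).
rewrite /cycle_weight -big_split /=.
have -> : t ^+ k = \prod_(l < k) t by rewrite prodr_const card_ord.
rewrite -big_split /=; apply: ler_prod => l _.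
by rewrite Ax_le mulr_ge0// ltW.
Qed.

Lemma max_mulmx_cV_leP (R : realType) n (A : 'M[R]_n) (x : 'cV[R]_n) (t : R) :
    (forall i, 0 < x i 0) -> 0 <= t ->
  mx_le (max_mulmx A x) (t *: x) <-> forall i j, A i j * x j 0 <= t * x i 0.
Proof.
move=> x_gt0 t_ge0; split=> [Ax_le i j|Ax_le i j].
  have := Ax_le i 0; rewrite !mxE; apply: le_trans.
  exact: (le_bigmax _ (fun k => A i k * x k 0)).
by rewrite ord1 !mxE; apply: bigmax_le => //; rewrite mulr_ge0// ltW.
Qed.

Lemma max_summxE (R : realType) m n p (A : 'I_m -> 'M[R]_(n, p)) i j :
  max_summx A i j = \big[Num.max/0]_(k < m) A k i j.
Proof.
rewrite /max_summx.
by apply: (big_morph (fun B : 'M[R]_(n, p) => B i j)) => [B C|]; rewrite mxE.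
Qed.

(** * Short cycles and arithmetic in Z/3 *)

Lemma cycle_weight1 (R : realType) n (A : 'M[R]_n) i :
  cycle_weight A [tuple i] = A i i.
Proof. by rewrite /cycle_weight big_ord_recl big_ord0 mulr1. Qed.

Lemma cycle_weight2 (R : realType) n (A : 'M[R]_n) i j :
  cycle_weight A [tuple i; j] = A i j * A j i.
Proof. by rewrite /cycle_weight !big_ord_recl big_ord0 mulr1. Qed.

Lemma cycle_weight3 (R : realType) n (A : 'M[R]_n) i j k :
  cycle_weight A [tuple i; j; k] = A i j * A j k * A k i.
Proof. by rewrite /cycle_weight !big_ord_recl big_ord0 mulr1 mulrA. Qed.

(** A nonzero [d] generates Z/3. Keeping [d] general treats both orientations of the 3-cycle at
    once. *)
Lemma I3_neq0_cases (d : 'I_3) : d != 0 ->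
  forall i j : 'I_3, [\/ j = i, j = i + d | j = i - d].
Proof.
move=> d_neq0 i j.
have : [|| j == i, j == i + d | j == i - d].
  by move: d i j d_neq0; do 3!case=> [[|[|[|?]]] ?].
by case/or3P=> /eqP; [constructor 1|constructor 2|constructor 3].
Qed.

Lemma I3_addrr (d : 'I_3) : d + d = - d.
Proof. by apply/eqP; move: d; case=> [[|[|[|?]]] ?]. Qed.

(* d = 1 or d = -1 in Z/3 is the orientation i -> i + d of a critical 3-cycle. *)
Definition critical_eigenvector (R : realType) (A : 'M[R]_3) (d : 'I_3)
    (x : 'cV[R]_3) : Prop :=
  [/\ d != 0,
      forall i, 0 < x i 0,
      forall i, A i (i + d) * x (i + d) 0 = max_cycle_mean A * x i 0
    & forall i j, A i j * x j 0 <= max_cycle_mean A * x i 0].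

Lemma sr_critical_eigenvector (R : realType) (A : 'M[R]_3) :
  sr_matrix A -> exists d x, critical_eigenvector A d x.
Proof.
case=> A_gt0 A_diag A_recip.
pose q (d : 'I_3) := A 0 d * A d (- d) * A (- d) 0.
have [d d_neq0 q_ge1] : exists2 d, d != 0 & 1 <= q d.
  have [q_ge1|q_lt1] := leP 1 (q 1); first by exists 1.
  exists (- 1) => //; rewrite /q opprK.
  have q_inv : q (- 1) * q 1 = 1.
    rewrite /q opprK.
    transitivity ((A 0 1 * A 1 0) * (A 0 (-1) * A (-1) 0) *
      (A 1 (-1) * A (-1) 1)); first by ring.
    by rewrite !A_recip// !mulr1.
  have q_gt0 : 0 < q 1 by rewrite /q !mulr_gt0.
  move: q_inv; rewrite {1}/q opprK => q_inv.
  by rewrite -(ler_pM2r q_gt0) mul1r q_inv ltW.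
have q_gt0 : 0 < q d by apply: lt_le_trans q_ge1.
pose t := q d `^ 3%:R^-1.
have t_gt0 : 0 < t by apply: powR_gt0.
have t_cube : t ^+ 3 = q d.
  by rewrite -powR_mulrn ?powR_ge0// -powRrM mulVf ?pnatr_eq0// powRr1 ?ltW.
have t_ge1 : 1 <= t.
  by rewrite -(@ler_pXn2r _ 3)// ?nnegrE ?(ltW t_gt0)// expr1n t_cube.
have nd_neq0 : - d != 0 by rewrite oppr_eq0.
have nd_neqd : - d != d.
  by move: d_neq0; clear; case: d => [[|[|[|?]]] ?].
(* With the entry at 0 normalized to 1, the eigenvector equation on the edges 0 -> d and -d -> 0
   forces the other two entries. On the remaining edge d -> -d it then amounts to [t_cube]. *)
pose x : 'cV[R]_3 := \col_i
  (if i == 0 then 1 else if i == d then t / A 0 d else A (- d) 0 / t).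
have x_gt0 i : 0 < x i 0.
  by rewrite mxE; case: ifP => // _; case: ifP => // _; rewrite divr_gt0.
have x_crit i : A i (i + d) * x (i + d) 0 = t * x i 0.
  have t_neq0 := lt0r_neq0 t_gt0.
  have A_neq0 k l : A k l != 0 by rewrite lt0r_neq0.
  have [->|->|->] := I3_neq0_cases d_neq0 0 i; rewrite !mxE ?sub0r ?add0r ?addNr.
  - by rewrite eqxx (negPf d_neq0) eqxx mulrC divfK// mulr1.
  - rewrite I3_addrr (negPf nd_neq0) (negPf nd_neqd) (negPf d_neq0) eqxx.
    apply: (mulIf t_neq0); rewrite -mulrA divfK//.
    apply: (mulfI (A_neq0 0 d)).
    have -> : A 0 d * (t * (t / A 0 d) * t) = t ^+ 3 * (A 0 d / A 0 d) by ring.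
    by rewrite mulfV// mulr1 t_cube /q mulrA.
  - by rewrite eqxx (negPf nd_neq0) (negPf nd_neqd) mulr1 mulrC divfK.
have x_sub i j : A i j * x j 0 <= t * x i 0.
  have [->|->|->] := I3_neq0_cases d_neq0 i j.
  - by rewrite A_diag ler_pM2r.
  - by rewrite x_crit.
  (* Backward edge: after multiplication by [t], reciprocity with the forward edge turns the claim
     into x_i <= t^2 x_i, which is where [t_ge1] enters. *)
  - have := x_crit (i - d); rewrite subrK => x_crit'.
    have ne : i != i - d by rewrite -subr_eq0 opprB addrC subrK.
    rewrite -(ler_pM2l t_gt0) [t * (A _ _ * _)]mulrCA -x_crit' mulrA A_recip// mul1r.
    by rewrite mulrA ler_peMl ?mulr_ege1 ?(ltW (x_gt0 i)).
have A_ge0 i j : 0 <= A i j by apply: ltW.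
(* The subeigenvector [x] bounds the mean from above, the 3-cycle of weight t^3 from below. *)
have mu_t : max_cycle_mean A = t.
  apply/eqP; rewrite eq_le (max_cycle_mean_le _ x_gt0 _ x_sub)//=; last exact: ltW.
  rewrite -(@ler_pXn2r _ 3)// ?nnegrE ?max_cycle_mean_ge0 ?(ltW t_gt0)// t_cube.
  rewrite /q -cycle_weight3 cycle_weight_le_mean//=.
  by rewrite !inE !negb_or [0 == _]eq_sym d_neq0 [0 == _]eq_sym nd_neq0 eq_sym nd_neqd.
by exists d, x; split=> // *; rewrite mu_t.
Qed.

(** * Rigidity along the critical cycle *)

Section CriticalEigenvector.
Variables (R : realType) (A : 'M[R]_3) (d : 'I_3) (x : 'cV[R]_3).
Hypotheses (A_sr : sr_matrix A) (x_crit : critical_eigenvector A d x).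
Let mu := max_cycle_mean A.

Lemma critical_mean_gt0 : 0 < mu.
Proof.
case: A_sr x_crit => A_gt0 _ _ [_ x_gt0 x_eq _].
by have := mulr_gt0 (A_gt0 0 (0 + d)) (x_gt0 (0 + d)); rewrite x_eq pmulr_lgt0.
Qed.

(* Going once around the critical cycle shows that z / x is constant. *)
Lemma critical_subeigenvector (z : 'cV[R]_3) :
    (forall i, 0 < z i 0) ->
    (forall i, A i (i + d) * z (i + d) 0 <= mu * z i 0) ->
  exists2 c, 0 < c & forall i, z i 0 = c * x i 0.
Proof.
case: A_sr x_crit => A_gt0 _ _ [d_neq0 x_gt0 x_eq _] z_gt0 z_sub.
pose r i := z i 0 / x i 0.
have r_le i : r (i + d) <= r i.
  rewrite /r ler_pdivrMr// mulrAC ler_pdivlMr// -(ler_pM2l critical_mean_gt0).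
  rewrite [mu * (_ * x i 0)]mulrCA -x_eq mulrCA !mulrA ler_pM2r//; exact: z_sub.
have r_const i : r i = r 0.
  have r1 := r_le 0; have r2 := r_le d; have r3 := r_le (- d).
  rewrite add0r in r1; rewrite I3_addrr in r2; rewrite addNr in r3.
  have [->|->|->] := I3_neq0_cases d_neq0 0 i => //; rewrite ?add0r ?sub0r.
  - by apply/eqP; rewrite eq_le r1 (le_trans r3 r2).
  - by apply/eqP; rewrite eq_le r3 (le_trans r2 r1).
by exists (r 0) => [|i]; rewrite ?divr_gt0// -(r_const i) divfK// lt0r_neq0.
Qed.

(** As [z] is a multiple of [x], the eigenvector equation holds for [z] on the critical edges and
    fixes the forward entries; reciprocity fixes the backward ones. So [f] is 1 at 0, [mu] at [d]
    and its inverse at [- d]. *)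
Lemma critical_circulant (z : 'cV[R]_3) :
    (forall i, 0 < z i 0) -> (forall i j, A i j * z j 0 <= mu * z i 0) ->
  exists f : 'I_3 -> R, forall i j, A i j = f (j - i) * (z i 0 / z j 0).
Proof.
move=> z_gt0 z_sub.
have [c c_gt0 zE] := critical_subeigenvector z_gt0 (fun i => z_sub i (i + d)).
case: A_sr x_crit => A_gt0 A_diag A_recip [d_neq0 x_gt0 x_eq _].
have z_neq0 i : z i 0 != 0 by rewrite lt0r_neq0.
have mu_neq0 : mu != 0 by rewrite lt0r_neq0// critical_mean_gt0.
have A_crit i : A i (i + d) = mu * (z i 0 / z (i + d) 0).
  apply: (mulIf (z_neq0 (i + d))); rewrite -mulrA divfK//.
  by rewrite !zE mulrCA x_eq mulrCA.
exists (fun e => if e == 0 then 1 else if e == d then mu else mu^-1) => i j.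
have [->|->|->] := I3_neq0_cases d_neq0 i j.
- by rewrite subrr eqxx mul1r mulfV.
- by rewrite addrAC subrr add0r (negPf d_neq0) eqxx A_crit.
- rewrite addrAC subrr sub0r oppr_eq0 (negPf d_neq0).
  have -> : (- d == d) = false.
    by apply/negbTE; move: d_neq0; clear; case: d => [[|[|[|?]]] ?].
  have ne : i != i - d by rewrite -subr_eq0 opprB addrC subrK.
  have := A_recip _ _ ne; have := A_crit (i - d); rewrite subrK => -> A_eq.
  have p_neq0 : mu * (z (i - d) 0 / z i 0) != 0.
    by rewrite mulf_neq0// mulf_neq0// invr_neq0.
  by apply: (mulIf p_neq0); rewrite A_eq; field; rewrite mu_neq0 !z_neq0.
Qed.

End CriticalEigenvector.

(** * Commutation and common subeigenvectors *)

Lemma max_mulmx_circulant (R : realType) n (A B : 'M[R]_n.+1)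
    (f g : 'I_n.+1 -> R) (z : 'cV[R]_n.+1) :
    (forall i, 0 < z i 0) ->
    (forall i j, A i j = f (j - i) * (z i 0 / z j 0)) ->
    (forall i j, B i j = g (j - i) * (z i 0 / z j 0)) ->
  max_mulmx A B = max_mulmx B A.
Proof.
move=> z_gt0 AE BE; apply/matrixP=> i j; rewrite !mxE.
(* The reflection k -> i + j - k exchanges the offsets k - i and j - k, hence the roles of [f] and
   [g]; the ratios of [z] telescope either way. *)
have h_inj : injective (fun k : 'I_n.+1 => i + j - k).
  by move=> k l /addrI/oppr_inj.
rewrite (reindex_inj h_inj) /=; apply: eq_bigr => k _.
rewrite !AE !BE.
have -> : i + j - k - i = j - k by rewrite addrAC [i + j]addrC addrK.
have -> : j - (i + j - k) = k - i.
  by rewrite opprB addrC -addrA opprD subrK.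
have z_neq0 l : z l 0 != 0 by rewrite lt0r_neq0.
by field; rewrite !z_neq0.
Qed.

(* Comparison at an index maximizing x / y. *)
Lemma subeigenvalue_le_mean (R : realType) (B : 'M[R]_3) (x : 'cV[R]_3) (c : R) :
    sr_matrix B -> (forall i, 0 < x i 0) ->
    (forall i, c * x i 0 <= max_mulmx B x i 0) ->
  c <= max_cycle_mean B.
Proof.
move=> B_sr x_gt0 x_sup.
have [d [y [_ y_gt0 _ y_sub]]] := sr_critical_eigenvector B_sr.
case: B_sr => B_gt0 _ _.
case: (arg_maxP (fun i => x i 0 / y i 0) (i0 := 0) (P := predT) isT) => k _ k_max.
rewrite -(ler_pM2r (x_gt0 k)); apply: le_trans (x_sup k) _.
rewrite mxE; apply: bigmax_le => [|j _].
  by rewrite mulr_ge0 ?max_cycle_mean_ge0 ?ltW.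
have x_le : x j 0 <= x k 0 / y k 0 * y j 0.
  by have := k_max j isT; rewrite /= ler_pdivrMr.
apply: le_trans (_ : B k j * (x k 0 / y k 0 * y j 0) <= _).
  by rewrite ler_pM2l.
rewrite mulrCA -[x k 0 in leRHS](divfK (lt0r_neq0 (y_gt0 k))) [leRHS]mulrCA ler_pM2l//.
by rewrite divr_gt0.
Qed.

Lemma commuting_subeigenvector (R : realType) (A B : 'M[R]_3) d (x : 'cV[R]_3) :
    sr_matrix A -> sr_matrix B -> critical_eigenvector A d x ->
    max_mulmx A B = max_mulmx B A ->
  forall i j, B i j * x j 0 <= max_cycle_mean B * x i 0.
Proof.
move=> A_sr B_sr x_crit AB_comm i j.
have mu_gt0 := critical_mean_gt0 A_sr x_crit.
case: (A_sr) (B_sr) (x_crit) => A_gt0 _ _ [B_gt0 _ _] [d_neq0 x_gt0 x_eq x_sub].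
have Bx_le k l : B k l * x l 0 <= max_mulmx B x k 0.
  by rewrite mxE (le_bigmax _ (fun l => B k l * x l 0)).
have Bx_gt0 k : 0 < max_mulmx B x k 0.
  by apply: lt_le_trans (Bx_le k 0); rewrite mulr_gt0.
(* This is A(Bx) = B(Ax) <= mu(A) Bx on critical edges, term by term: each product of entries of [A]
   and [B] is bounded by an entry of the matrix product, where commutation swaps the factors. *)
have Bx_sub k : A k (k + d) * max_mulmx B x (k + d) 0 <=
    max_cycle_mean A * max_mulmx B x k 0.
  have A_pos := A_gt0 k (k + d).
  rewrite mulrC -ler_pdivlMr// [max_mulmx B x (k + d) 0]mxE.
  apply: bigmax_le => [|l _].
    by rewrite divr_ge0// ?mulr_ge0// ltW.
  rewrite ler_pdivlMr// mulrAC -ler_pdivlMr//.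
  apply: le_trans (_ : max_mulmx A B k l <= _).
    by rewrite mulrC mxE (le_bigmax _ (fun m => A k m * B m l)).
  rewrite AB_comm mxE; apply: bigmax_le => [|m _].
    by rewrite divr_ge0 ?mulr_ge0// ltW.
  rewrite ler_pdivlMr// -mulrA.
  apply: le_trans (_ : max_cycle_mean A * (B k m * x m 0) <= _).
    by rewrite [leRHS]mulrCA ler_pM2l.
  by rewrite ler_pM2l.
have [c c_gt0 BxE] := critical_subeigenvector A_sr x_crit Bx_gt0 Bx_sub.
apply: le_trans (Bx_le i j) _; rewrite BxE ler_pM2r//.
by apply: (subeigenvalue_le_mean B_sr x_gt0) => k; rewrite BxE.
Qed.

Theorem theorem3p3 (R : realType) (m : nat) (hm : (0 < m)%N)
    (A : 'I_m -> 'M[R]_3) (hA : forall i : 'I_m, sr_matrix (A i)) :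
  (max_cycle_mean (max_summx (fun i : 'I_m => normalized_mx (A i))) = 1
   <-> (forall i j : 'I_m, max_mulmx (A i) (A j) = max_mulmx (A j) (A i))) /\
  ((forall i j : 'I_m, max_mulmx (A i) (A j) = max_mulmx (A j) (A i))
   <-> (exists x : 'cV[R]_3, (forall l : 'I_3, 0 < x l 0) /\
          forall i : 'I_m,
            mx_le (max_mulmx (A i) x) (max_cycle_mean (A i) *: x))).
Proof.
set S := max_summx _.
have mu_gt0 k : 0 < max_cycle_mean (A k).
  by have [d [x x_crit]] := sr_critical_eigenvector (hA k);
     exact: critical_mean_gt0 (hA k) x_crit.
have A_gt0 k i j : 0 < A k i j by case: (hA k).
(* Entrywise form of (iii), to which both (i) and (ii) are shown equivalent. *)
pose common_sub (x : 'cV[R]_3) := (forall l, 0 < x l 0) /\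
  forall k i j, A k i j * x j 0 <= max_cycle_mean (A k) * x i 0.
have common_subE : (exists x : 'cV[R]_3, (forall l : 'I_3, 0 < x l 0) /\
    forall k, mx_le (max_mulmx (A k) x) (max_cycle_mean (A k) *: x)) <->
    exists x, common_sub x.
  split=> -[x [x_gt0 x_sub]]; exists x; split=> // k.
    by apply/max_mulmx_cV_leP; rewrite // ltW.
  by apply/max_mulmx_cV_leP; rewrite // ltW.
(* The critical eigenvector of this one matrix is the candidate for the common subeigenvector,
   starting from (i) as well as from (ii). *)
pose k0 := Ordinal hm.
have [d [x x_crit]] := sr_critical_eigenvector (hA k0).
have [d_neq0 x_gt0 x_eq x_sub] := x_crit.
have S_ge k i j : (max_cycle_mean (A k))^-1 * A k i j <= S i j.
  rewrite max_summxE.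
  by have := le_bigmax 0 (fun k => normalized_mx (A k) i j) k; rewrite mxE.
have S_ge0 i j : 0 <= S i j by rewrite max_summxE bigmax_ge_id.
have S_crit i : x i 0 / x (i + d) 0 <= S i (i + d).
  apply: le_trans (S_ge k0 _ _).
  by rewrite ler_pdivrMr// -mulrA x_eq mulKf// lt0r_neq0.
have S_back i : x (i - d) 0 / x i 0 <= S (i - d) i.
  by have := S_crit (i - d); rewrite subrK.
have S_next i : x (i + d) 0 / x (i - d) 0 <= S (i + d) (i - d).
  by have := S_crit (i + d); rewrite -addrA I3_addrr.
have x_neq0 i : x i 0 != 0 by rewrite lt0r_neq0.
have d_path i : uniq [:: i; i + d; i - d].
  by move: d_neq0; clear; move: i d; do 2!case=> [[|[|[|?]]] ?].
have comm_sub : (forall i j, max_mulmx (A i) (A j) = max_mulmx (A j) (A i)) <->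
    exists x, common_sub x.
  split=> [A_comm|[z [z_gt0 z_sub]] i j].
    exists x; split=> // k.
    exact: commuting_subeigenvector (hA k0) (hA k) x_crit (A_comm _ _).
  (* The critical orientation [e] may vary with [k], but the conjugating vector [z] is shared, so
     the circulant forms are compatible. *)
  have circ k : exists f : 'I_3 -> R,
      forall i j, A k i j = f (j - i) * (z i 0 / z j 0).
    have [e [y y_crit]] := sr_critical_eigenvector (hA k).
    exact: critical_circulant (hA k) y_crit _ z_gt0 (z_sub k).
  have [f fE] := circ i; have [g gE] := circ j.
  exact: max_mulmx_circulant z_gt0 fE gE.
have mean_sub : max_cycle_mean S = 1 <-> exists x, common_sub x.
  split=> [S_mean|[z [z_gt0 z_sub]]].
    have S_cycle k (s : k.+1.-tuple 'I_3) : uniq s -> cycle_weight S s <= 1.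
      by move=> s_uniq; rewrite (le_trans (cycle_weight_le_mean _ _ _))// S_mean expr1n.
    suff Sx_le i j : S i j * x j 0 <= x i 0.
      exists x; split=> // k i j.
      rewrite -ler_pdivrMl// mulrA; apply: le_trans (Sx_le i j).
      by rewrite ler_pM2r.
    have edge_le j' (w : R) : x j' 0 / x i 0 <= w -> S i j' * w <= 1 ->
        S i j' * x j' 0 <= x i 0.
      move=> w_ge w_le; rewrite -[leRHS]mul1r -ler_pdivrMr// -mulrA.
      by apply: le_trans w_le; rewrite ler_wpM2l.
    (* A cycle of S through the edge (i, j) has weight at most 1, and its
       remaining edges are bounded below by the critical ratios of x. *)
    have [->|->|->] := I3_neq0_cases d_neq0 i j.
    - by have := S_cycle 0%N [tuple i] isT; rewrite cycle_weight1 ger_pMl.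
    - have := S_cycle 2 [tuple i; i + d; i - d] (d_path i).
      rewrite cycle_weight3 -mulrA; apply: edge_le.
      have -> : x (i + d) 0 / x i 0 =
          x (i + d) 0 / x (i - d) 0 * (x (i - d) 0 / x i 0).
        by rewrite mulrA divfK.
      by rewrite ler_pM// divr_ge0 ?(ltW (x_gt0 _)).
    - have i_neq : uniq [:: i; i - d].
        have := d_path i; rewrite /= !inE negb_or => /andP[/andP[_ i_neq] _].
        by rewrite andbT.
      have := S_cycle 1%N [tuple i; i - d] i_neq; rewrite cycle_weight2.
      exact: edge_le.
  apply/eqP; rewrite eq_le; apply/andP; split.
    apply: (max_cycle_mean_le S_ge0 z_gt0 ler01) => i j.
    rewrite mul1r -ler_pdivlMr// max_summxE; apply: bigmax_le => [|k _].
      by rewrite divr_ge0// ltW.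
    by rewrite !mxE ler_pdivlMr// -mulrA ler_pdivrMl.
  (* On the critical cycle of [A k0] the entries of [S] dominate the ratios of [x], whose product
     around the cycle is 1. *)
  rewrite -(@ler_pXn2r _ 3) ?nnegrE ?max_cycle_mean_ge0// expr1n.
  apply: le_trans (cycle_weight_le_mean (s := [tuple 0; 0 + d; 0 - d]) S_ge0 isT (d_path 0)).
  rewrite cycle_weight3.
  have -> : 1 = x 0 0 / x (0 + d) 0 * (x (0 + d) 0 / x (0 - d) 0) * (x (0 - d) 0 / x 0 0).
    by field; rewrite !x_neq0.
  by rewrite !ler_pM ?mulr_ge0 ?invr_ge0 ?(ltW (x_gt0 _)).
by split; [rewrite mean_sub comm_sub|rewrite comm_sub common_subE].
Qed.
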